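(* Let $M$ be a rank-$r$ real symmetric $n\times n$ matrix, and let $M=AA^T$ with $A\in\mathbb{R}^{n\times r}_{\ge 0}$ be a size-$r$ completely positive factorization of $M$. If this factorization is locally rigid but not infinitesimally rigid, then $$\operatorname{K\text{-}rank}(Z_A)<\min\left(c,\binom r2\right),$$ where $c$ is the number of columns of $Z_A$.
   Context: Let $a_1^T,\dots,a_n^T$ be the rows of $A$. $A$ (or the factorization $AA^T$) is locally rigid if $A$ is an isolated point of the set $\{X\in\mathbb{R}^{n\times r} : XX^T=M,\ X\ge 0 \text{ entrywise}\}$. An infinitesimal motion of $A$ is a matrix $\dot A\in\mathbb{R}^{n\times r}$ with rows $\dot a_1^T,\dots,\dot a_n^T$ such that $a_i^T\dot a_j+\dot a_i^Ta_j=0$ for all $(i,j)\in[n]\times[n]$, and such that for some $\epsilon>0$, $a_i+t\dot a_i\ge 0$ entrywise for all $i$ and all $t\in[0,\epsilon)$. $A$ is infinitesimally rigid if it has no (nonzero) infinitesimal motions. The space of skew-symmetric $r\times r$ real matrices $D$ is identified with $\mathbb{R}^{\binom r2}$ via the coordinates $d_{ij}$, $i<j$. $W_A\subseteq\mathbb{R}^{\binom r2}$ is the polyhedral cone of those skew-symmetric $D$ for which $AD$ is an infinitesimal motion of $A$; it is given by the inequalities $d_j^Ta_i\ge 0$, one for each $(i,j)$ such that the $j$th entry of $a_i$ is zero, where $d_j$ is the $j$th column of $D$. The vectors in $\mathbb{R}^{\binom r2}$ representing the linear functionals $D\mapsto d_j^Ta_i$ for these $(i,j)$ are the generators of the dual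 cone $W_A^\vee$. $Z_A$ is the matrix whose columns are these generators of $W_A^\vee$. The Kruskal rank $\operatorname{K\text{-}rank}(Z)$ of a matrix $Z$ is the maximal $k$ such that any $k$ columns of $Z$ are linearly independent. *)

(* Defs.v *)
From mathcomp Require Import all_boot all_order all_algebra.
From mathcomp Require Import boolp classical_sets reals topology normedtype.
Set Implicit Arguments.
Unset Strict Implicit.
Unset Printing Implicit Defensive.
Import Order.TTheory GRing.Theory Num.Theory.
Import numFieldNormedType.Exports.
Local Open Scope classical_set_scope.
Local Open Scope ring_scope.

Definition nonneg_mx (R : realType) (n r : nat) (A : 'M[R]_(n, r)) : Prop :=
  forall i j, 0 <= A i j.

Definition cp_factorizations (R : realType) (n r : nat) (M : 'M[R]_n) :
    set 'M[R]_(n, r) :=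
  [set X | X *m X^T = M /\ nonneg_mx X].

Definition locally_rigid (R : realType) (n r : nat) (A : 'M[R]_(n, r)) : Prop :=
  isolated (cp_factorizations (A *m A^T)) A.

Definition infinitesimal_motion (R : realType) (n r : nat)
    (A dA : 'M[R]_(n, r)) : Prop :=
  (forall i j : 'I_n,
     row i A *m (row j dA)^T + row i dA *m (row j A)^T = 0) /\
  (exists2 eps : R, 0 < eps &
     forall t : R, 0 <= t -> t < eps -> nonneg_mx (A + t *: dA)).

Definition infinitesimally_rigid (R : realType) (n r : nat)
    (A : 'M[R]_(n, r)) : Prop :=
  forall dA : 'M[R]_(n, r), infinitesimal_motion A dA -> dA = 0.

(* The index set of the coordinates d_{kl}, k < l, on skew-symmetric r x r
   matrices. *)
Definition upper_pairs (r : nat) : {set 'I_r * 'I_r} :=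
  [set p : 'I_r * 'I_r | (p.1 < p.2)%N]%SET.

Lemma card_upper_pairs (r : nat) : #|upper_pairs r| = 'C(r, 2).
Proof.
rewrite -sum1_card (eq_bigl (fun p : 'I_r * 'I_r => true && (p.1 < p.2)%N));
  last first.
  by move=> p; rewrite inE.
rewrite -(pair_big_dep xpredT (fun i j : 'I_r => (i < j)%N) (fun _ _ => 1%N)).
rewrite /= (exchange_big_dep xpredT) //= -bin2_sum big_mkord.
apply: eq_bigr => j _.
by rewrite (big_ord_narrow (ltnW (ltn_ord j))) sum_nat_const card_ord muln1.
Qed.

(* The skew-symmetric matrix with coordinates d_{kl} = v_{kl} for k < l. *)
Definition skew_mx (R : realType) (r : nat) (v : 'rV[R]_#|upper_pairs r|) :
    'M[R]_r :=
  \sum_(p < #|upper_pairs r|)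
    let: (k, l) := enum_val p in v 0 p *: (delta_mx k l - delta_mx l k).

Definition motion_cone (R : realType) (n r : nat) (A : 'M[R]_(n, r)) :
    set 'rV[R]_#|upper_pairs r| :=
  [set v | infinitesimal_motion A (A *m skew_mx v)].

Definition zero_entries (R : realType) (n r : nat) (A : 'M[R]_(n, r)) :
    {set 'I_n * 'I_r} :=
  [set q : 'I_n * 'I_r | A q.1 q.2 == 0]%SET.

(* The functional D |-> d_j^T a_i attached to q = (i, j). *)
Definition motion_functional (R : realType) (n r : nat) (A : 'M[R]_(n, r))
    (q : 'I_n * 'I_r) (D : 'M[R]_r) : R :=
  ((col q.2 D)^T *m (row q.1 A)^T) 0 0.

(* The entry in row p of a column is the value of the corresponding functional
   on the p-th coordinate vector.  There is one column per zero entry of A, so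
   zero or repeated columns are kept. *)
Definition Zmx (R : realType) (n r : nat) (A : 'M[R]_(n, r)) :
    'M[R]_(#|upper_pairs r|, #|zero_entries A|) :=
  \matrix_(p, q) motion_functional A (enum_val q) (skew_mx (delta_mx 0 p)).

(* The largest k, at most the number c of columns, such that any k columns
   (i.e. those at any k distinct positions) are linearly independent. *)
Definition kruskal_rank (F : fieldType) (m c : nat) (Z : 'M[F]_(m, c)) : nat :=
  \max_(k < c.+1 |
     [forall S : {set 'I_c}, (#|S| == k) ==> free [seq col j Z | j in S]]) k.

Lemma motion_functionalE (R : realType) (n r : nat) (A : 'M[R]_(n, r)) q D :
  motion_functional A q D = (A *m D) q.1 q.2.
Proof.
rewrite /motion_functional -trmx_mul !mxE.
by apply: eq_bigr => k _; rewrite !mxE.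
Qed.

Lemma skew_mx_sum (R : realType) (r : nat) (v : 'rV[R]_#|upper_pairs r|) :
  skew_mx v = \sum_p v 0 p *: skew_mx (delta_mx 0 p).
Proof.
apply: eq_bigr => p _; rewrite /skew_mx (bigD1 p) //= big1 ?addr0.
  by case: (enum_val p) => k l; rewrite mxE !eqxx scale1r.
move=> s sp; case: (enum_val s) => k l.
by rewrite mxE (negbTE sp) andbF scale0r.
Qed.

Lemma skew_mx_skew (R : realType) (r : nat) (v : 'rV[R]_#|upper_pairs r|) :
  (skew_mx v)^T = - skew_mx v.
Proof.
rewrite /skew_mx raddf_sum -sumrN; apply: eq_bigr => p _ /=.
case: (enum_val p) => k l.
by rewrite linearZ /= linearB /= !trmx_delta -scalerN opprB.
Qed.

Lemma mul_ZmxE (R : realType) (n r : nat) (A : 'M[R]_(n, r)) v q :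
  (v *m Zmx A) 0 q = motion_functional A (enum_val q) (skew_mx v).
Proof.
rewrite motion_functionalE skew_mx_sum mulmx_sumr summxE mxE.
by apply: eq_bigr => p _; rewrite mxE motion_functionalE -scalemxAr [RHS]mxE.
Qed.

Lemma motion_coneE (R : realType) (n r : nat) (A : 'M[R]_(n, r)) :
  nonneg_mx A ->
  motion_cone A = [set v | forall q, 0 <= (v *m Zmx A) 0 q].
Proof.
move=> A0; apply/seteqP; split=> v /=.
  move=> [_ [e e0 H]] q; rewrite mul_ZmxE motion_functionalE.
  have := enum_valP q; rewrite inE => /eqP Aq.
  have e2 : 0 < e / 2 by rewrite divr_gt0.
  have lte : e / 2 < e by rewrite ltr_pdivrMr // ltr_pMr // ltr1n.
  have := H (e / 2) (ltW e2) lte (enum_val q).1 (enum_val q).2.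
  by rewrite mxE [X in _ + X]mxE Aq add0r pmulr_rge0.
move=> v0; set B := A *m skew_mx v.
have B0 i j : A i j = 0 -> 0 <= B i j.
  move=> Aij; have ij : (i, j) \in zero_entries A by rewrite inE /= Aij.
  have := v0 (enum_rank_in ij (i, j)).
  by rewrite mul_ZmxE motion_functionalE enum_rankK_in.
have AB : A *m B^T + B *m A^T = 0.
  by rewrite /B trmx_mul skew_mx_skew mulNmx mulmxN mulmxA addNr.
change (infinitesimal_motion A B).
clearbody B; split=> [i j|].
  apply/matrixP => a b; move/matrixP: AB => /(_ i j); rewrite !mxE => AB.
  by rewrite -[RHS]AB; congr (_ + _); apply: eq_bigr => k _; rewrite !mxE.
pose f (p : 'I_n * 'I_r) : R :=
  if A p.1 p.2 == 0 then 1 else A p.1 p.2 / (1 + `|B p.1 p.2|).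
have B1 p q : 0 < 1 + `|B p q| by rewrite ltr_pwDl.
exists (\big[Num.min/1]_p f p).
  apply: lt_bigmin => [|p _]; first exact: ltr01.
  rewrite /f; case: eqP => [_|/eqP Ap]; first exact: ltr01.
  by rewrite divr_gt0 ?B1 // lt_def Ap A0.
move=> t t0 te i j; rewrite !mxE.
have tf : t < f (i, j) by rewrite (lt_le_trans te) // bigmin_le_cond.
move: tf; rewrite /f /=; case: eqP => [Aij _|_].
  by rewrite Aij add0r mulr_ge0 // B0.
rewrite ltr_pdivlMr // => /ltW tA; apply: (le_trans _ (lerD tA (lexx _))).
rewrite -mulrDr mulr_ge0 // -addrA addr_ge0 //.
by rewrite -[X in _ + X]opprK subr_ge0 -normrN ler_norm.
Qed.

(* Main.v *)
Require Import Defs.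
From mathcomp Require Import all_boot all_order all_algebra.
From mathcomp Require Import boolp classical_sets reals topology normedtype.
From mathcomp Require Import lra.
Import Order.TTheory GRing.Theory Num.Theory.
Import numFieldNormedType.Exports.
Local Open Scope ring_scope.

(** The rank condition makes [A] row-full, so every tangent direction to the
    fibre of [X |-> X *m X^T] at [A] is [A *m D] with [D] skew-symmetric: the
    failure of infinitesimal rigidity is a nonzero vector [v] of the cone
    [v *m Z >= 0], where [Z] is [Zmx A].

    Suppose the Kruskal rank [k] of [Z] were at least [min(c, m)], with
    [m = 'C(r, 2)].  The columns of [Z] annihilated by [v] are then at most
    [k] in number: otherwise [m <= k], and [k] independent columns annihilated
    by [v] would span everything and force [v = 0].  They are thus among [k]
    independent columns, and some [w] takes the value 1 on all of them.  For
    small [t > 0], [v + t *: w] is positive on every column: the cone has an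
    interior point ([cone_point_gt0]).

    For such a direction [D], each zero entry of [A] has a positive derivative
    along [A *m D].  The Cayley transform turns [D] into a curve of orthogonal
    matrices tangent to [D *+ 2] at the identity, and moving [A] along it keeps
    [A *m A^T] fixed and, for small times, the entries nonnegative
    ([not_locally_rigid_of_skew]).  So [A] is not isolated among the
    factorizations, contradicting local rigidity. *)

(** * Kruskal rank and independent columns *)

Lemma sub_supset_card {T : finType} (S : {set T}) (k : nat) :
  (#|S| <= k <= #|T|)%N -> exists2 U : {set T}, S \subset U & #|U| = k.
Proof.
move=> /andP[Sk]; elim: k Sk => [|k IHk].
  by rewrite leqn0 => /eqP S0 _; exists S.
rewrite leq_eqVlt ltnS => /predU1P[Sk _|Sk kT]; first by exists S.
have [U SU Uk] := IHk Sk (ltnW kT).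
have /subsetPn[x _ xU] : ~~ ([set: T]%SET \subset U).
  by apply/negP => /subset_leq_card; rewrite Uk cardsT leqNgt kT.
exists (x |: U)%SET; first by rewrite (fintype.subset_trans SU) // subsetU1.
by rewrite cardsU1 xU Uk.
Qed.

Lemma kruskal_rank_le {F : fieldType} {m c : nat} (Z : 'M[F]_(m, c)) :
  (kruskal_rank Z <= c)%N.
Proof. by apply/bigmax_leqP => k _; rewrite -ltnS. Qed.

(** The maximum defining the Kruskal rank ranges over a nonempty set, since the
    empty family is free, so it is attained. *)
Lemma kruskal_rank_free {F : fieldType} {m c : nat} (Z : 'M[F]_(m, c))
    (S : {set 'I_c}) :
  #|S| = kruskal_rank Z -> free [seq col j Z | j in S].
Proof.
have P0 : [forall T : {set 'I_c},
    (#|T| == (ord0 : 'I_c.+1) :> nat) ==> free [seq col j Z | j in T]].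
  apply/forallP => T; apply/implyP; rewrite cards_eq0 => /eqP ->.
  by rewrite /image_mem enum_set0 nil_free.
rewrite /kruskal_rank (bigop.bigmax_eq_arg ord0) //.
case: arg_maxnP => //= k /forallP/(_ S)/implyP kfree _ Sk.
by apply: kfree; rewrite Sk.
Qed.

Lemma mulmx_col_entry {F : fieldType} {m c : nat} (w : 'rV[F]_m)
    (Z : 'M[F]_(m, c)) (j : 'I_c) :
  (w *m Z) 0 j = (w *m col j Z) 0 0.
Proof. by rewrite !mxE; apply: eq_bigr => i _; rewrite mxE. Qed.

(** The sum of the coordinates along a free family is a linear form, equal to 1
    on each member of the family. *)
Lemma free_cols_separated {F : fieldType} {m c : nat} (Z : 'M[F]_(m, c))
    (S : {set 'I_c}) :
  free [seq col j Z | j in S] ->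
  exists w : 'rV[F]_m, forall j, j \in S -> (w *m Z) 0 j = 1.
Proof.
set s := image_mem _ _ => sfree; pose X := in_tuple s.
pose f (x : 'cV[F]_m) := \sum_i coord X i x.
exists (\row_p f (delta_mx p 0)) => j jS.
have fE x : ((\row_p f (delta_mx p 0)) *m x) 0 0 = f x.
  rewrite [x in RHS]matrix_sum_delta /f mxE.
  under [RHS]eq_bigr do rewrite linear_sum.
  rewrite exchange_big; apply: eq_bigr => p _ /=.
  rewrite mxE mulr_suml; apply: eq_bigr => i _.
  by rewrite big_ord1 linearZ /= mulrC.
rewrite mulmx_col_entry fE.
have js : col j Z \in s by apply: fintype.image_f.
have hlt : (index (col j Z) s < size s)%N by rewrite index_mem.
have -> : col j Z = X`_(Ordinal hlt) by rewrite /= nth_index.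
rewrite /f (bigD1 (Ordinal hlt)) // big1.
  by rewrite coord_free // eqxx /= addr0.
by move=> i /andP[_ ine]; rewrite coord_free // eq_sym (negbTE ine).
Qed.

(** So many independent columns form a basis of the whole space of column
    vectors. *)
Lemma annihilator_free_cols {F : fieldType} {m c : nat} (Z : 'M[F]_(m, c))
    (v : 'rV[F]_m) (S : {set 'I_c}) :
  (m <= #|S|)%N -> free [seq col j Z | j in S] ->
  (forall j, j \in S -> (v *m Z) 0 j = 0) -> v = 0.
Proof.
move=> mS sfree vS; set s := image_mem _ _ in sfree.
pose X := in_tuple s.
have ss : size s = #|S| by rewrite size_map -cardE.
have sfull : basis_of fullv X.
  by rewrite basisEfree sfree subvf dimvf dim_matrix mulr1 /= ss.
apply/rowP => p; rewrite [RHS]mxE.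
have -> : v 0 p = (v *m delta_mx p (0 : 'I_1)) 0 0.
  by rewrite -colE mxE.
rewrite (coord_basis sfull (memvf (delta_mx p 0))) mulmx_sumr summxE.
apply: big1 => i _; rewrite -scalemxAr mxE.
have /mapP[j] : X`_i \in s by apply: mem_nth.
by rewrite mem_enum => jS ->; rewrite -mulmx_col_entry vS // mulr0.
Qed.

(** * Interior points of the cone *)

(** Where [a i] vanishes the linear term decides the sign, elsewhere the
    constant term does; finitely many indices allow a common range of [t].  The quadratic
    term accounts for the second-order remainder of a curve. *)
Lemma near0_perturbation_gt0 {R : realType} {I : finType} (a b : I -> R)
    (C : R) :
  (forall i, 0 <= a i) -> (forall i, a i = 0 -> 0 < b i) -> 0 <= C ->
  \forall t \near ((0 : R)^'+)%classic, forall i, 0 < a i + t * (b i - t * C).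
Proof.
move=> a0 ab C0; apply: filter_forall => i.
have C1 : 0 < 1 + C by rewrite ltr_pwDl.
have [ai|ai] := eqVneq (a i) 0.
  near=> t.
  have t0 : 0 < t by near: t; exact: nbhs_right_gt.
  have : t < b i / (1 + C).
    by near: t; apply: nbhs_right_lt; rewrite divr_gt0 // ab.
  by rewrite ltr_pdivlMr // => tb; rewrite ai add0r mulr_gt0 //; lra.
have ai0 : 0 < a i by rewrite lt_def ai a0.
have D1 : 0 < 1 + `|b i| + C by rewrite addrAC ltr_pwDl.
near=> t.
have t0 : 0 < t by near: t; exact: nbhs_right_gt.
have t1 : t < 1 by near: t; exact: nbhs_right_lt.
have : t < a i / (1 + `|b i| + C).
  by near: t; apply: nbhs_right_lt; rewrite divr_gt0.
rewrite ltr_pdivlMr // => ta.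
have bn : - `|b i| <= b i by rewrite lerNl -normrN ler_norm.
have := ler_wpM2l (ltW t0) bn.
have := ler_wpM2r C0 (ltW t1).
move=> /(ler_wpM2l (ltW t0)).
lra.
Unshelve. all: by end_near.
Qed.

(** A large Kruskal rank makes independent the columns where [v] vanishes, so
    that [v] can be moved off all the walls of the cone that contain it. *)
Lemma cone_point_gt0 {R : realType} {m c : nat} (Z : 'M[R]_(m, c))
    (v : 'rV[R]_m) :
  (minn c m <= kruskal_rank Z)%N -> v != 0 -> (forall q, 0 <= (v *m Z) 0 q) ->
  exists2 v' : 'rV[R]_m, v' != 0 & forall q, 0 < (v' *m Z) 0 q.
Proof.
move=> kge v0 vZ.
set k := kruskal_rank Z in kge.
pose S := [set q | (v *m Z) 0 q == 0]%SET.
have Sk : (#|S| <= k)%N.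
  have Sc : (#|S| <= c)%N by rewrite -[leqRHS]card_ord max_card.
  rewrite leqNgt; apply/negP => kS.
  have mk : (m <= k)%N.
    by move: kge; rewrite geq_min leqNgt (leq_trans kS Sc).
  have /card_geqP[s [us sk sS]] := ltnW kS.
  have Tk : #|[set q in s]%SET| = k by rewrite cardsE -sk; exact/card_uniqP.
  move/eqP: v0; apply.
  apply: (annihilator_free_cols Z v [set q in s]%SET); first by rewrite Tk.
    exact: kruskal_rank_free.
  by move=> j; rewrite inE => /sS; rewrite inE => /eqP.
(* Freeness is known for families of exactly [k] columns only, hence the
   enlargement of [S]. *)
have [T ST Tk] : exists2 T : {set 'I_c}, S \subset T & #|T| = k.
  by apply: sub_supset_card; rewrite Sk card_ord kruskal_rank_le.
have [w wT] := free_cols_separated Z T (kruskal_rank_free Z T Tk).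
(* If no column is annihilated, [v] itself is suitable; otherwise a value at
   [q0] shows that the perturbed vector is nonzero. *)
have [S0|[q0 q0S]] := set_0Vmem S.
  exists v => // q; rewrite lt_def vZ andbT.
  by apply/negP => vq; have : q \in S; [rewrite inE | rewrite S0 inE].
have near_gt0 := near0_perturbation_gt0 (fun q => (v *m Z) 0 q)
  (fun q => (w *m Z) 0 q) 0 vZ.
have {near_gt0} vwZ : \forall t \near ((0 : R)^'+)%classic,
    forall q, 0 < (v *m Z) 0 q + t * ((w *m Z) 0 q - t * 0).
  apply: near_gt0 => // q vq; rewrite wT ?ltr01 //.
  by apply: (fintype.subsetP ST); rewrite inE vq.
near ((0 : R)^'+)%classic => t.
have vtwZ q : 0 < ((v + t *: w) *m Z) 0 q.
  have : 0 < (v *m Z) 0 q + t * ((w *m Z) 0 q - t * 0).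
    by move: q; near: t.
  by rewrite mulr0 subr0 mulmxDl -scalemxAl !mxE.
exists (v + t *: w) => //.
by apply/eqP => vw0; have := vtwZ q0; rewrite vw0 mul0mx mxE ltxx.
Unshelve. all: by end_near.
Qed.

(** * The Cayley transform *)

(** If [x *m D = x] then [x *m x^T = x *m D *m x^T], which is zero because [D] is
    skew-symmetric; over a real field this forces [x = 0]. *)
Lemma skew_sub1_unit {R : realFieldType} {r : nat} (D : 'M[R]_r) :
  D^T = - D -> 1%:M - D \in unitmx.
Proof.
move=> DT; rewrite -row_free_unit; apply: inj_row_free => x.
rewrite mulmxBr mulmx1 => /eqP; rewrite subr_eq0 => /eqP xD.
have xDx : x *m D *m x^T = 0.
  have : (x *m D *m x^T)^T = - (x *m D *m x^T).
    by rewrite !trmx_mul trmxK DT mulNmx mulmxN mulmxA.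
  move/matrixP => /(_ 0 0); rewrite !mxE => h.
  apply/matrixP => a b; rewrite !ord1 [RHS]mxE mxE.
  lra.
move: xDx; rewrite -xD => /matrixP/(_ 0 0).
rewrite !mxE => /psumr_eq0P xx; apply/rowP => j; rewrite mxE.
have /xx/(_ j isT) : forall j, true -> 0 <= x 0 j * x^T j 0.
  by move=> l _; rewrite mxE -expr2 sqr_ge0.
by rewrite mxE => /eqP; rewrite mulf_eq0 orbb => /eqP.
Qed.

(** Here [P] is the inverse of [1 - D], so that [P *+ 2 - 1] is the Cayley
    transform [(1 + D) (1 - D)^-1].  Everything follows from
    [2 P P^T = P + P^T]: orthogonality by expanding, and the bound because the
    diagonal reads [\sum_k P i k ^+ 2 = P i i], whence [P i i <= 1] and then
    [P i k ^+ 2 <= 1].  A bound independent of [D] is what controls remainders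
    uniformly along the curve [t *: D]. *)
Lemma cayley_resolvent {R : realFieldType} {r : nat} (D : 'M[R]_r) :
  D^T = - D -> exists P : 'M[R]_r,
    [/\ P = 1%:M + D *m P, (P *+ 2 - 1%:M) *m (P *+ 2 - 1%:M)^T = 1%:M
      & forall i j, `|P i j| <= 1].
Proof.
move=> DT; have Du := skew_sub1_unit D DT.
pose P : 'M[R]_r := invmx (1%:M - D); exists P.
have PD : P *m (1%:M - D) = 1%:M by rewrite mulVmx.
have DP : (1%:M - D) *m P = 1%:M by rewrite mulmxV.
have PDT : (1%:M + D) *m P^T = 1%:M.
  by rewrite -[1%:M + D]trmxK -trmx_mul linearD /= trmx1 DT PD trmx1.
have PPT : P *m P^T *+ 2 = P + P^T.
  have -> : P *m P^T *+ 2 = P *m ((1%:M + D) + (1%:M - D)) *m P^T.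
    by rewrite addrACA subrr addr0 mulmxDr mulmx1 mulmxDl mulr2n.
  by rewrite mulmxDr mulmxDl -mulmxA PDT mulmx1 PD mul1mx.
split.
- by move/eqP: DP; rewrite mulmxBl mul1mx subr_eq => /eqP.
- have QPT : (P *+ 2 - 1%:M) *m P^T = P.
    by rewrite mulmxBl mul1mx mulr2n mulmxDl -mulr2n PPT addrK.
  rewrite linearB linearMn /= trmx1 mulmxBr mulmx1 [P^T *+ 2]mulr2n mulmxDr.
  by rewrite QPT -mulr2n opprB addrC subrK.
- move=> i j.
  have Pii : \sum_k P i k ^+ 2 = P i i.
    move/matrixP: PPT => /(_ i i); rewrite mulmxnE !mxE.
    under eq_bigr do rewrite mxE -expr2.
    by move=> h; lra.
  have Pik k : P i k ^+ 2 <= P i i.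
    rewrite -Pii (bigD1 k) //= lerDl sumr_ge0 // => l _.
    exact: sqr_ge0.
  have Pi1 : P i i <= 1 by have := Pik i; nra.
  rewrite -(ler_pXn2r (n := 2)) ?nnegrE // expr1n real_normK ?num_real //.
  exact: le_trans (Pik j) Pi1.
Qed.

(** * Infinitesimal motions and skew-symmetric matrices *)

Lemma row_full_factor {F : fieldType} {n r : nat} (A : 'M[F]_(n, r)) :
  \rank (A *m A^T) = r -> row_full A.
Proof.
by move=> Ar; rewrite /row_full eqn_leq rank_leq_col -{1}Ar mxrankM_maxl.
Qed.

(** With a left inverse [B] of [A], the relation [A dA^T + dA A^T = 0] multiplied
    on the right by [B^T] expresses [dA] as [A *m D]; cancelling [A] on the left
    and [A^T] on the right then makes [D] skew-symmetric. *)
Lemma motion_skew {R : realType} {n r : nat} (A dA : 'M[R]_(n, r)) :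
  row_full A -> infinitesimal_motion A dA ->
  exists2 D : 'M[R]_r, D^T = - D & dA = A *m D.
Proof.
move=> Afull [tangent _].
have AdA : A *m dA^T = - (dA *m A^T).
  apply/eqP; rewrite -addr_eq0; apply/eqP/matrixP => i j.
  have /matrixP/(_ 0 0) := tangent i j; rewrite !mxE => h.
  by rewrite -[RHS]h; congr (_ + _); apply: eq_bigr => k _; rewrite !mxE.
have [B BA] := row_fullP Afull.
have ATBT : A^T *m B^T = 1%:M by rewrite -trmx_mul BA trmx1.
pose D := - (B *m dA)^T.
have dAE : dA = A *m D.
  rewrite /D trmx_mul mulmxN mulmxA AdA mulNmx opprK -mulmxA ATBT.
  by rewrite mulmx1.
exists D => //.
move: AdA; rewrite dAE trmx_mul mulmxA -mulNmx => /(congr1 (mulmx^~ B^T)) /=.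
rewrite -!mulmxA ATBT !mulmx1 -mulmxN.
exact: row_full_inj.
Qed.

Lemma skew_mx_coord {R : realType} {r : nat} (v : 'rV[R]_#|upper_pairs r|) p :
  skew_mx v (enum_val p).1 (enum_val p).2 = v 0 p.
Proof.
have := enum_valP p; rewrite inE; case Ep : (enum_val p) => [k l] /= kl.
rewrite /skew_mx summxE (bigD1 p) //= big1 ?addr0.
  rewrite Ep !mxE !eqxx /=.
  by rewrite -val_eqE /= (ltn_eqF kl) subr0 mulr1.
move=> q qp; have := enum_valP q; rewrite inE.
case Eq : (enum_val q) => [k' l'] /= kl'; rewrite !mxE.
have [/andP[/eqP ek /eqP el]|_] := boolP ((k == k') && (l == l')).
  by case/eqP: qp; apply: enum_val_inj; rewrite Ep Eq ek el.
have [/andP[/eqP ek /eqP el]|_] := boolP ((k == l') && (l == k')).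
  by move: kl; rewrite ek el ltnNge ltnW.
by rewrite subrr mulr0.
Qed.

Lemma skew_mx_surj {R : realType} {r : nat} (D : 'M[R]_r) :
  D^T = - D -> exists v, skew_mx v = D.
Proof.
move=> DT; pose v : 'rV[R]_#|upper_pairs r| :=
  \row_p D (enum_val p).1 (enum_val p).2.
have skew (B : 'M[R]_r) k l : B^T = - B -> B l k = - B k l.
  by move=> /matrixP/(_ k l); rewrite !mxE.
have vE (k l : 'I_r) : (k < l)%N -> skew_mx v k l = D k l.
  move=> kl; have klU : (k, l) \in upper_pairs r by rewrite inE.
  have := skew_mx_coord v (enum_rank_in klU (k, l)).
  by rewrite mxE enum_rankK_in.
exists v; apply/matrixP => k l.
have [kl|lk|/val_inj <-] := ltngtP k l; first exact: vE.
  by rewrite (skew D) // -vE // -skew // skew_mx_skew.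
have := skew _ k k (skew_mx_skew v); have := skew _ k k DT.
lra.
Qed.

(** * From a strict motion to a curve of factorizations *)

(** With [P] the inverse of [1 - t *: D], the curve [X t = A *m (P *+ 2 - 1)]
    equals both [A + 2t A D P] and [A + 2t A D + 2t^2 A D^2 P].  As [P] is bounded
    uniformly in [t], the first form shows that [X t] tends to [A], and the second
    that its entries are nonnegative for small [t > 0].  As [P] is
    invertible and [A D] nonzero, [A D P] is nonzero and [X t <> A]. *)
Lemma not_locally_rigid_of_skew {R : realType} {n r : nat}
    (A : 'M[R]_(n, r)) (D : 'M[R]_r) :
  nonneg_mx A -> D^T = - D -> A *m D != 0 ->
  (forall i j, A i j = 0 -> 0 < (A *m D) i j) -> ~ locally_rigid A.
Proof.
move=> A0 DT AD0 ADgt0 [_ [V /nbhs_ballP[e /= e0 AeV] VA]].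
have entry_bound (B : 'M[R]_(n, r)) (P : 'M[R]_r) i j :
    (forall k l, `|P k l| <= 1) ->
    `|(B *m P) i j| <= \sum_(q : 'I_n * 'I_r) `|B q.1 q.2|.
  move=> P1; rewrite mxE (le_trans (ler_norm_sum _ _ _)) //.
  rewrite -(pair_bigA _ (fun a b => `|B a b|)) /= (bigD1 i) //=.
  rewrite ler_wpDr //.
    by apply: sumr_ge0 => a _; apply: sumr_ge0.
  apply: ler_sum => k _; rewrite normrM ler_piMr //.
pose C1 := \sum_(q : 'I_n * 'I_r) `|(A *m D) q.1 q.2|.
pose C2 := \sum_(q : 'I_n * 'I_r) `|(A *m D *m D) q.1 q.2|.
have C1_ge0 : 0 <= C1 by apply: sumr_ge0.
have C2_ge0 : 0 <= C2 by apply: sumr_ge0.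
have near_gt0 : \forall t \near ((0 : R)^'+)%classic, forall q : 'I_n * 'I_r,
    0 < A q.1 q.2 + t * ((A *m D *+ 2) q.1 q.2 - t * (C2 *+ 2)).
  apply: near0_perturbation_gt0 => [q|q|]; first exact: A0.
    by move=> /ADgt0; rewrite mulmxnE pmulrn_lgt0.
  by rewrite mulrn_wge0.
near ((0 : R)^'+)%classic => t.
have t0 : 0 < t by near: t; exact: nbhs_right_gt.
have te : t < e / (1 + C1 *+ 2).
  near: t; apply: nbhs_right_lt.
  by rewrite divr_gt0 // ltr_pwDl // mulrn_wge0.
have tDT : (t *: D)^T = - (t *: D) by rewrite linearZ /= DT scalerN.
have [P [PE Porth P1]] := cayley_resolvent (t *: D) tDT.
pose X := A *m (P *+ 2 - 1%:M).
have PB : P *+ 2 - 1%:M = 1%:M + (t *: D *m P) *+ 2.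
  by rewrite {1}PE mulrnDl addrAC mulr2n addrK.
have XE1 : X = A + t *: (A *m D *m P) *+ 2.
  by rewrite /X PB mulmxDr mulmx1 mulr2n mulmxDr -mulr2n -scalemxAl -scalemxAr
    mulmxA.
have XE2 : X = A + (t *: (A *m D) + t ^+ 2 *: (A *m D *m D *m P)) *+ 2.
  rewrite XE1 {1}PE mulmxDr mulmx1 scalerDr -scalemxAl -scalemxAr scalerA.
  by rewrite -expr2 !mulmxA.
have XS : cp_factorizations (A *m A^T) X.
  split; first by rewrite /X trmx_mul mulmxA -(mulmxA A) Porth mulmx1.
  move=> i j; apply: ltW.
  have : 0 < A i j + t * ((A *m D *+ 2) i j - t * (C2 *+ 2)).
    have : forall q : 'I_n * 'I_r,
        0 < A q.1 q.2 + t * ((A *m D *+ 2) q.1 q.2 - t * (C2 *+ 2)).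
      by near: t.
    by move/(_ (i, j)).
  have := entry_bound (A *m D *m D) P i j P1.
  rewrite -/C2 ler_norml => /andP[+ _].
  move=> /(ler_wpM2l (sqr_ge0 t)) tC.
  rewrite XE2 [X in _ -> _ < X]mxE !mulmxnE.
  rewrite [X in _ -> _ < _ + X *+ 2]mxE [X in _ -> _ < _ + (X + _) *+ 2]mxE.
  rewrite [X in _ -> _ < _ + (_ + X) *+ 2]mxE.
  set x := (A *m D) i j; set y := (A *m D *m D *m P) i j in tC *.
  lra.
have XV : V X.
  apply: AeV; split => // i j.
  rewrite -ball_normE /= XE1 mxE opprD addNKr normrN mulmxnE mxE.
  rewrite -mulr_natr !normrM (gtr0_norm t0) normr_nat.
  have := entry_bound (A *m D) P i j P1; rewrite -/C1.
  move=> /(ler_wpM2l (ltW t0)) tC.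
  move: te; rewrite ltr_pdivlMr ?ltr_pwDl ?mulrn_wge0 // => te.
  lra.
have : (V `&` cp_factorizations (A *m A^T))%classic X by [].
rewrite VA /= => XA; move/eqP: AD0; apply.
have ADP0 : A *m D *m P = 0.
  move: XE1; rewrite XA => /(congr1 (fun Y => Y - A)).
  rewrite subrr addrAC subrr add0r => /esym/eqP.
  by rewrite -scaler_nat !scaler_eq0 pnatr_eq0 (gt_eqF t0) => /eqP.
have PV : P *m (1%:M - t *: D) = 1%:M.
  by apply: mulmx1C; rewrite mulmxBl mul1mx {1}PE addrK.
by rewrite -[A *m D]mulmx1 -PV mulmxA ADP0 mul0mx.
Unshelve. all: by end_near.
Qed.

(** * The bound on the Kruskal rank *)

Theorem proposition6p9 (R : realType) (n r : nat) (M : 'M[R]_n)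
    (A : 'M[R]_(n, r)) :
  M^T = M -> \rank M = r ->
  M = A *m A^T -> nonneg_mx A ->
  locally_rigid A -> ~ infinitesimally_rigid A ->
  (kruskal_rank (Zmx A) < minn #|zero_entries A| 'C(r, 2))%N.
Proof.
move=> _ rankM ME A0 locrig not_infrig; rewrite ltnNge; apply/negP => krank.
have Afull : row_full A by apply: row_full_factor; rewrite -ME.
apply: not_infrig => dA dA_motion; apply: contrapT => /eqP dA0.
have [D DT dAE] := motion_skew A dA Afull dA_motion.
have [v vD] := skew_mx_surj D DT.
have v0 : v != 0.
  apply/eqP => v0; move/eqP: dA0; apply; rewrite dAE -vD skew_mx_sum.
  by rewrite big1 ?mulmx0 // => p _; rewrite v0 mxE scale0r.
have vcone : motion_cone A v by rewrite /motion_cone /= vD -dAE.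
rewrite motion_coneE //= in vcone.
rewrite -card_upper_pairs in krank.
have [v' v'0 v'Z] := cone_point_gt0 _ v krank v0 vcone.
have AD'0 i j : A i j = 0 -> 0 < (A *m skew_mx v') i j.
  move=> Aij; have ij : (i, j) \in zero_entries A by rewrite inE /= Aij.
  have := v'Z (enum_rank_in ij (i, j)).
  by rewrite mul_ZmxE motion_functionalE enum_rankK_in.
apply: (not_locally_rigid_of_skew A (skew_mx v')) => //.
  exact: skew_mx_skew.
apply/eqP; rewrite -(mulmx0 _ A) => /(row_full_inj Afull) D0.
by move/eqP: v'0; apply; apply/rowP => p; rewrite -skew_mx_coord D0 !mxE.
Qed.
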